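(* Let $p>3$ be a prime. Then $$2\sum_{k=1}^{p-1}\frac{(-1)^{k-1}}{k^5\binom{2k}{k}}-\frac{5}{2}\sum_{k=1}^{p-1}\frac{(-1)^{k-1}H_{k-1}(2)}{k^3\binom{2k}{k}}\equiv-\frac{6}{5}B_{p-5}\pmod{p}.$$
   Context: For integers $n\ge 0$ and $a\ge 1$, $H_n(a)=\sum_{k=1}^n \frac{1}{k^a}$ (empty sum is $0$). $B_m\in\mathbb{Q}$ are the Bernoulli numbers defined by $\frac{t}{e^t-1}=\sum_{m\ge 0}B_m\frac{t^m}{m!}$. For rational numbers $x,y$ (whose denominators may be divisible by $p$), $x\equiv y\pmod{p^r}$ means that $x-y$ has $p$-adic valuation at least $r$. *)

(* Defs.v *)
From mathcomp Require Import all_boot all_order all_algebra.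

Set Implicit Arguments.
Unset Strict Implicit.
Unset Printing Implicit Defensive.

Import Order.TTheory GRing.Theory Num.Theory.
Local Open Scope ring_scope.

Definition harmonic (n a : nat) : rat := \sum_(1 <= k < n.+1) (k%:R ^+ a)^-1.

(* A formal power series over Q is its coefficient sequence nat -> rat. *)
Definition fps_mul (f g : nat -> rat) : nat -> rat :=
  fun n => \sum_(i < n.+1) f i * g (n - i)%N.

(* The first n coefficients of 1 / f, computed from the Cauchy product. *)
Fixpoint fps_inv_seq (f : nat -> rat) (n : nat) : seq rat :=
  if n is m.+1 then
    let s := fps_inv_seq f m in
    rcons s (((m == 0)%:R - \sum_(i < m) s`_i * f (m - i)%N) / f 0%N)
  else [::].

(* The inverse of f when f 0 != 0. *)
Definition fps_inv (f : nat -> rat) : nat -> rat :=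
  fun n => (fps_inv_seq f n.+1)`_n.

(* B_m = m! [t^m] ((e^t - 1) / t)^-1, hence B_1 = -1/2. *)
Definition bernoulli (m : nat) : rat :=
  m`!%:R * fps_inv (fun n => (n.+1`!%:R)^-1) m.

Lemma size_fps_inv_seq f n : size (fps_inv_seq f n) = n.
Proof. by elim: n => //= n IHn; rewrite size_rcons IHn. Qed.

Lemma nth_fps_inv_seq f n i :
  (i < n)%N -> (fps_inv_seq f n)`_i = fps_inv f i.
Proof.
elim: n => // n IHn; rewrite ltnS leq_eqVlt => /orP[/eqP -> // | lt_in].
by rewrite /= nth_rcons size_fps_inv_seq lt_in IHn.
Qed.

Lemma fps_mul_inv f n :
  f 0%N != 0 -> fps_mul (fps_inv f) f n = (n == 0)%:R.
Proof.
move=> f0; rewrite /fps_mul big_ord_recr /= subnn {2}/fps_inv /=.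
rewrite nth_rcons size_fps_inv_seq ltnn eqxx divfK //.
rewrite [X in _ + (_ - X)](eq_bigr (fun i : 'I_n => fps_inv f i * f (n - i)%N)).
  by rewrite addrC subrK.
by move=> i _; rewrite nth_fps_inv_seq.
Qed.

(* (sum_m B_m t^m / m!) * (e^t - 1) = t *)
Lemma bernoulli_egf n :
  fps_mul (fun m => bernoulli m / m`!%:R)
          (fun m => (m`!%:R)^-1 - (m == 0)%:R) n = (n == 1)%:R.
Proof.
rewrite /fps_mul big_ord_recr /= subnn fact0 invr1 subrr mulr0 addr0.
case: n => [|n]; first by rewrite big_ord0.
rewrite eqSS -(@fps_mul_inv (fun n => (n.+1`!%:R)^-1)) /fps_mul; last first.
  by rewrite invr_eq0 pnatr_eq0 -lt0n fact_gt0.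
apply: eq_bigr => i _; have le_in : (i <= n)%N by rewrite -ltnS ltn_ord.
rewrite subSn // subr0 /bernoulli; congr (_ * _).
by rewrite mulrC mulKf // pnatr_eq0 -lt0n fact_gt0.
Qed.

Lemma bernoulli_unique (b : nat -> rat) :
    (forall n, fps_mul (fun m => b m / m`!%:R)
       (fun m => (m`!%:R)^-1 - (m == 0)%:R) n = (n == 1)%:R) ->
  b =1 bernoulli.
Proof.
move=> Hb n; elim/ltn_ind: n => n IHn.
have := Hb n.+1; rewrite -bernoulli_egf /fps_mul.
rewrite !big_ord_recr /= !subnn fact0 invr1 subrr !mulr0 !addr0.
rewrite (eq_bigr (fun i : 'I_n => bernoulli i / i`!%:R *
   (((n.+1 - i)`!%:R)^-1 - (n.+1 - i == 0)%N%:R))); last first.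
  by move=> i _; rewrite IHn.
move/addrI; rewrite subSnn subr0 invr1 !mulr1; apply: mulIf.
by rewrite invr_eq0 pnatr_eq0 -lt0n fact_gt0.
Qed.

(* The p-adic valuation of a nonzero rational; junk value 0 at x = 0. *)
Definition padic_val (p : nat) (x : rat) : int :=
  (logn p `|numq x|)%:Z - (logn p `|denq x|)%:Z.

(* x = y mod p^r; the first disjunct is v_p(0) = +oo. *)
Definition eq_mod_rat (p : nat) (r : int) (x y : rat) : Prop :=
  x = y \/ r <= padic_val p (x - y).

(* Main.v *)
Require Import Defs.
From HB Require Import structures.
From mathcomp Require Import all_boot all_order all_algebra cyclic.
From mathcomp Require Import ring lra zify.

(** The left-hand side is a partial sum of the series in Koecher's formula
    for zeta(5).  Write H_n(a) for [harmonic n a], H(a,b) for the sum over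
    k < p of H_(k-1)(a) / k^b, and rho(n,k) = 1 / ('C(n+k,k) 'C(n,k)).
    Koecher's formula has an exact finite form ([koecher_finite]): with
    n = p - 1 the left-hand side equals H_n(5) - R/2, where R is the sum over
    k <= n of (-1)^(k-1) H_(k-1)(2) rho(n,k) / k^3.  Only R has a factor p in
    its denominators, and these are explicit:
    p (-1)^k rho(p-1,k) = k + p modulo p^2 ([congp_rho]).  Hence
    p R = - H(2,2) - p H(2,3) modulo p^2.  Since 2 H(2,2) = H_n(2)^2 - H_n(4),
    with H_n(2) divisible by p, and H_n(5) is divisible by p when p > 5, the
    left-hand side is H(2,3)/2 - H_n(4)/(4p) modulo p.

    The value of H_n(4) modulo p^2 comes from two evaluations of the complete
    symmetric function h_4 of 1, 1/2, ..., 1/n.  It is an alternating sum of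
    the 'C(n,k) / k^4 ([star_sum_bin]), in which
    (-1)^k 'C(p-1,k) = 1 - p H_k(1) modulo p^2; and by Newton's identities it
    is H_n(4)/4 plus products of power sums that vanish modulo p^2.  The
    comparison gives H_n(4) = (4/5) p H(1,4) modulo p^2 ([congp_harmonic4]),
    without Kummer's congruences.

    The double sums H(1,4) and H(2,3) are then needed only modulo p.  There
    1/j^a = j^(p-1-a), Faulhaber's formula turns H_(k-1)(a) into a polynomial
    in k whose coefficients are Bernoulli numbers, and summing it against
    1/k^b retains a single one, of index p-a-b ([congp_mhs2]).  This gives
    H(1,4) = B_(p-5) and H(2,3) = -2 B_(p-5), so the left-hand side is
    (-1 - 1/5) B_(p-5).

    For p = 5, H_n(4) is not divisible by p and the argument breaks down; the
    difference of the two sides is then computed to be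
    5^3 7793 / (2^8 3^5 7). *)

Set Implicit Arguments.
Unset Strict Implicit.
Unset Printing Implicit Defensive.

Import Order.TTheory GRing.Theory Num.Theory.
Local Open Scope ring_scope.

(** * Congruences modulo prime powers in the rationals *)

(** For prime p this is the localization of the integers at p. *)
Definition zloc (p : nat) := [qualify a x : rat | coprime p `|denq x|].

(** Any denominator prime to p will do, reduced or not; this makes the
    closure properties immediate. *)
Lemma zlocP p x :
  reflect (exists2 d : nat, coprime p d & d%:R * x \is a Num.int)
          (x \is a zloc p).
Proof.
apply: (iffP idP) => [px|[d pd /intrP[z dxz]]].
  exists `|denq x|%N => //.
  by rewrite pmulrn absz_denq mulrC -numqE intr_int.
rewrite qualifE /=; apply: coprime_dvdr pd.
have dvd_dn : (denq x %| d%:Z * numq x)%Z.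
  apply/dvdzP; exists z; apply/eqP; rewrite -(eqr_int rat) !intrM numqE.
  by rewrite mulrA -dxz.
move: dvd_dn; rewrite mulrC Gauss_dvdzr // coprimezE.
by rewrite coprime_sym; apply: coprime_num_den.
Qed.

Fact zloc_subring_closed p : subring_closed (zloc p).
Proof.
split=> [|x y /zlocP[d pd dx] /zlocP[e pe ey]
          |x y /zlocP[d pd dx] /zlocP[e pe ey]].
- apply/zlocP; exists 1%N; first exact: coprimen1.
  by rewrite mulr1; exact: int_num1.
- apply/zlocP; exists (d * e)%N; first by rewrite coprimeMr pd.
  have -> : (d * e)%:R * (x - y) = e%:R * (d%:R * x) - d%:R * (e%:R * y) by ring.
  by apply: rpredB; apply: rpredM => //; apply: rpred_nat.
apply/zlocP; exists (d * e)%N; first by rewrite coprimeMr pd.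
have -> : (d * e)%:R * (x * y) = (d%:R * x) * (e%:R * y) by ring.
exact: rpredM.
Qed.
HB.instance Definition _ p :=
  GRing.isSubringClosed.Build rat _ (zloc_subring_closed p).

Lemma zlocV p k : coprime p k -> k%:R^-1 \is a zloc p.
Proof.
move=> pk; apply/zlocP; exists k => //.
have [->|k0] := eqVneq (k%:R : rat) 0; first by rewrite mul0r.
by rewrite mulfV.
Qed.

Lemma zlocV_lt p k : prime p -> (0 < k < p)%N -> k%:R^-1 \is a zloc p.
Proof.
move=> pp /andP[k0 kp]; apply: zlocV; rewrite prime_coprime //.
by rewrite gtnNdvd.
Qed.

Definition congp (p r : nat) (x y : rat) : bool :=
  (x - y) / p%:R ^+ r \is a zloc p.

Notation "x == y %[modp p ^ r ]" := (congp p r x y)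
  (at level 70, y at next level, p at level 2, r at level 8,
   format "x  ==  y  %[modp  p ^ r ]").

(** For x <> y write x - y = p w: since p does not divide the denominator
    of w, the valuation of x - y is one more than that of the numerator of
    w. *)
Lemma eq_mod_ratP p x y :
  prime p -> x == y %[modp p ^ 1] -> eq_mod_rat p 1 x y.
Proof.
rewrite /congp expr1 => pp; set w := _ / _ => wZ.
have p0 : p%:R != 0 :> rat by rewrite pnatr_eq0 -lt0n prime_gt0.
have zE : x - y = p%:R * w by rewrite mulrC divfK.
have pn0 : p != 0%N by rewrite -lt0n prime_gt0.
have [w0|w0] := eqVneq w 0.
  by left; apply/eqP; rewrite -subr_eq0 zE w0 mulr0.
right; have z0 : x - y != 0 by rewrite zE mulf_neq0.
rewrite /padic_val.
have E : (numq (x - y) * denq w)%R = p%:Z * numq w * denq (x - y).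
  apply/eqP; rewrite -(eqr_int rat) !intrM !numqE; apply/eqP.
  by rewrite {1}zE /=; ring.
have := congr1 (fun z => logn p `|z|%N) E.
rewrite !abszM !lognM ?muln_gt0 ?absz_gt0 ?numq_eq0 ?z0 ?denq_neq0 ?w0 ?pn0
  // (pfactorK 1) //.
have -> : logn p `|denq w| = 0%N.
  move: wZ; rewrite qualifE /= prime_coprime // lognE => /negbTE ->.
  by rewrite !andbF.
by rewrite addn0 => ->; rewrite !PoszD addrK lerDl.
Qed.

Section Congruences.
Variables (p : nat) (p_prime : prime p).

Let p_neq0 : p%:R != 0 :> rat.
Proof. by rewrite pnatr_eq0 -lt0n prime_gt0. Qed.

Lemma congp_refl r x : x == x %[modp p ^ r].
Proof. by rewrite /congp subrr mul0r rpred0. Qed.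

Lemma congp_sym r x y : (x == y %[modp p ^ r]) = (y == x %[modp p ^ r]).
Proof. by rewrite /congp -opprB mulNr rpredN. Qed.

Lemma congp_trans r y x z :
  x == y %[modp p ^ r] -> y == z %[modp p ^ r] -> x == z %[modp p ^ r].
Proof.
move=> xy yz; rewrite /congp.
rewrite (_ : x - z = (x - y) + (y - z)); last by ring.
by rewrite mulrDl rpredD.
Qed.

Lemma congp_sub0 r x y : (x - y == 0 %[modp p ^ r]) = (x == y %[modp p ^ r]).
Proof. by rewrite /congp subr0. Qed.

Lemma congpW r s x y : (r <= s)%N -> x == y %[modp p ^ s] -> x == y %[modp p ^ r].
Proof.
move=> le_rs xy; rewrite /congp.
rewrite (_ : _ / _ = (x - y) / p%:R ^+ s * p%:R ^+ (s - r)).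
  by rewrite rpredM // rpredX ?rpred_nat.
rewrite -{1}(subnK le_rs) exprD; field.
by rewrite !expf_neq0.
Qed.

Lemma congpD r x x' y y' : x == x' %[modp p ^ r] -> y == y' %[modp p ^ r] ->
  x + y == x' + y' %[modp p ^ r].
Proof. by move=> xx' yy'; rewrite /congp opprD addrACA mulrDl rpredD. Qed.

Lemma congpN r x y : x == y %[modp p ^ r] -> - x == - y %[modp p ^ r].
Proof. by rewrite /congp -opprD mulNr rpredN. Qed.

Lemma congpB r x x' y y' : x == x' %[modp p ^ r] -> y == y' %[modp p ^ r] ->
  x - y == x' - y' %[modp p ^ r].
Proof. by move=> xx' yy'; apply: congpD => //; apply: congpN. Qed.

Lemma congpMl r c x y : c \is a zloc p -> x == y %[modp p ^ r] ->
  c * x == c * y %[modp p ^ r].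
Proof. by move=> cZ xy; rewrite /congp -mulrBr -mulrA rpredM. Qed.

Lemma congpMr r c x y : c \is a zloc p -> x == y %[modp p ^ r] ->
  x * c == y * c %[modp p ^ r].
Proof. by move=> cZ xy; rewrite -![_ * c]mulrC; apply: congpMl. Qed.

Lemma congpM0 r s x y : x == 0 %[modp p ^ r] -> y == 0 %[modp p ^ s] ->
  x * y == 0 %[modp p ^ (r + s)].
Proof.
by rewrite /congp !subr0 exprD invfM mulrACA => *; rewrite rpredM.
Qed.

Lemma congp_sum r m n (F G : nat -> rat) :
  (forall k, (m <= k < n)%N -> F k == G k %[modp p ^ r]) ->
  \sum_(m <= k < n) F k == \sum_(m <= k < n) G k %[modp p ^ r].
Proof.
move=> FG; rewrite /congp -sumrB big_distrl /= big_nat.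
by apply: rpred_sum => k /FG.
Qed.

(** Trades a power of p in the modulus for a factor p: the way to remove
    the denominators p from a congruence. *)
Lemma congp_pscale r x y :
  (p%:R * x == p%:R * y %[modp p ^ r.+1]) = (x == y %[modp p ^ r]).
Proof. by rewrite /congp -mulrBr exprS invfM mulrACA mulfV // mul1r. Qed.

Lemma zloc_congp0 x : x \is a zloc p -> p%:R * x == 0 %[modp p ^ 1].
Proof. by rewrite -(mulr0 p%:R) congp_pscale /congp subr0 divr1. Qed.

End Congruences.

(** * A finite form of Koecher's identity *)

Lemma harmonicS n a : harmonic n.+1 a = harmonic n a + (n.+1%:R ^+ a)^-1.
Proof. by rewrite /harmonic big_nat_recr. Qed.

Lemma harmonic0 a : harmonic 0 a = 0.
Proof. by rewrite /harmonic big_geq. Qed.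

Lemma binS_rat n k : 'C(n.+1, k.+1)%:R = n.+1%:R / k.+1%:R * 'C(n, k)%:R :> rat.
Proof.
have k0 : k.+1%:R != 0 :> rat by rewrite pnatr_eq0.
apply: (mulfI k0); rewrite -natrM -mul_bin_diag natrM; field.
by rewrite ?natr1 ?nat1r ?pnatr_eq0.
Qed.

Lemma bin_succ_rat n k : (k <= n)%N ->
  'C(n, k)%:R = (n.+1%:R - k%:R) / n.+1%:R * 'C(n.+1, k)%:R :> rat.
Proof.
move=> le_kn; have n0 : n.+1%:R != 0 :> rat by rewrite pnatr_eq0.
apply: (mulfI n0); rewrite -natrM (mul_bin_down n.+1) natrM natrB ?leqW //.
by field; rewrite ?natr1 ?nat1r ?pnatr_eq0.
Qed.

(** The weight in the remainder of the finite form of Koecher's identity;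
    divided by 2 k^3 it is the quantity with which Apery accelerates the
    series for zeta(3). *)
Definition rho (n k : nat) : rat := ('C(n + k, k) * 'C(n, k))%:R^-1.

Lemma rhonn n : rho n n = 'C(2 * n, n)%:R^-1.
Proof. by rewrite /rho binn muln1 addnn mul2n. Qed.

Lemma rhon0 n : rho n 0 = 1.
Proof. by rewrite /rho !bin0 invr1. Qed.

Lemma rhoS m k : (k < m)%N ->
  rho m k.+1 = rho m k * k.+1%:R ^+ 2 / ((m%:R - k%:R) * (m%:R + k%:R + 1)).
Proof.
move=> lt_km; rewrite /rho !natrM addnS binS_rat.
have -> : 'C(m, k.+1)%:R = (m%:R - k%:R) / k.+1%:R * 'C(m, k)%:R :> rat.
  have k0 : k.+1%:R != 0 :> rat by rewrite pnatr_eq0.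
  apply: (mulfI k0); rewrite -natrM mul_bin_left natrM natrB ?(ltnW lt_km) //.
  by field; rewrite ?natr1 ?nat1r ?pnatr_eq0.
have C1 : 'C(m + k, k) != 0%N by rewrite -lt0n bin_gt0 leq_addl.
have C2 : 'C(m, k) != 0%N by rewrite -lt0n bin_gt0 ltnW.
field; rewrite -natrB ?(ltnW lt_km) // -natrD ?natr1 ?nat1r !pnatr_eq0.
by rewrite subn_eq0 -ltnNge lt_km C1 C2.
Qed.

Lemma rho_succ m k : (k <= m)%N ->
  rho m k = rho m.+1 k * (m.+1%:R + k%:R) / (m.+1%:R - k%:R).
Proof.
move=> le_km; rewrite /rho !natrM addSn.
rewrite (bin_succ_rat le_km) (@bin_succ_rat (m + k) k) ?leq_addl //.
have C1 : 'C((m + k).+1, k)%:R != 0 :> rat.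
  by rewrite pnatr_eq0 -lt0n bin_gt0 leqW ?leq_addl.
have C2 : 'C(m.+1, k)%:R != 0 :> rat by rewrite pnatr_eq0 -lt0n bin_gt0 leqW.
have N0 : m.+1%:R - k%:R != 0 :> rat.
  by rewrite -natrB ?leqW // pnatr_eq0 subn_eq0 -ltnNge ltnS.
have N1 : m.+1%:R + k%:R != 0 :> rat by rewrite -natrD pnatr_eq0 addSn.
have N2 : m.+1%:R != 0 :> rat by rewrite pnatr_eq0.
have -> : (m + k).+1%:R = m.+1%:R + k%:R :> rat by rewrite -addSn natrD.
move: (m.+1%:R) ('C(m.+1, k)%:R) ('C((m + k).+1, k)%:R) N0 N1 N2 C1 C2.
move=> M c c' N0 N1 N2 C1 C2; field.
by rewrite N0 C1 C2 N2 N1.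
Qed.

(** This telescopes in K.  It is the coefficient of x^2 in the identity
      1/X = sum_(k <= K) (a_1 ... a_(k-1)) / ((X+a_1) ... (X+a_k))
            + (a_1 ... a_K) / (X (X+a_1) ... (X+a_K))
    for X = m^2 - x^2 and a_k = x^2 - k^2: the factors X + a_k = m^2 - k^2 do
    not depend on x, and with the factorials they make up rho(m,k), while
    a_1 ... a_(k-1) has relative x^2-coefficient - H_(k-1)(2). *)
Lemma inv_quartic_expansion m K : (K < m)%N ->
  (m%:R ^+ 4)^-1 + \sum_(1 <= k < K.+1) (-1) ^+ (k - 1) * m%:R * rho m k *
     harmonic (k - 1) 2 / (k%:R ^+ 2 * (m%:R - k%:R))
  = (-1) ^+ K * rho m K / (m%:R * (m%:R - K%:R))
    * ((m%:R ^+ 2)^-1 - harmonic K 2).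
Proof.
have m0 : (K < m)%N -> m%:R != 0 :> rat by case: m => // m _; rewrite pnatr_eq0.
elim: K m0 => [|K IHK] m0 lt_Km.
  by rewrite big_geq // rhon0 harmonic0; field; rewrite m0.
rewrite big_nat_recr //= addrA IHK ?(ltnW lt_Km) //; last by move=> _; apply: m0.
rewrite subn1 /= harmonicS rhoS ?(ltnW lt_Km) // (exprS _ K).
have := m0 lt_Km.
have A1 : m%:R - K%:R != 0 :> rat.
  by rewrite -natrB ?pnatr_eq0 ?subn_eq0 -?ltnNge ltnW // ltnW.
have A2 : m%:R - K.+1%:R != 0 :> rat.
  by rewrite -natrB ?pnatr_eq0 ?subn_eq0 -?ltnNge // ltnW.
have A3 : m%:R + K.+1%:R != 0 :> rat by rewrite -natrD pnatr_eq0 addnS.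
have A4 : K.+1%:R != 0 :> rat by rewrite pnatr_eq0.
move: A2 A3 A4; rewrite -natr1 => A2 A3 A4 m1.
by field; rewrite m1 A1 A2 -?addrA A3 A4.
Qed.

(** Induction on n.  Passing from n to m = n + 1 changes the weights by
    rho(n,k) - rho(m,k) = 2k rho(m,k) / (m-k), and the resulting sum is the
    one evaluated at the last level K = n by [inv_quartic_expansion]; the
    weight at the boundary, rho(m,m) = 1 / 'C(2m,m), yields the central
    binomial coefficients. *)
Lemma koecher_finite n :
  2 * \sum_(1 <= k < n.+1) (-1) ^+ (k - 1) / (k%:R ^+ 5 * 'C(2 * k, k)%:R)
  - 5 / 2 * \sum_(1 <= k < n.+1) (-1) ^+ (k - 1) * harmonic (k - 1) 2
                                 / (k%:R ^+ 3 * 'C(2 * k, k)%:R)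
  = harmonic n 5 - 2^-1 * \sum_(1 <= k < n.+1)
      (-1) ^+ (k - 1) * harmonic (k - 1) 2 * rho n k / k%:R ^+ 3.
Proof.
elim: n => [|n IHn]; first by rewrite !big_geq // harmonic0; ring.
move: IHn; move Dm: n.+1 => m IHn.
have m1 : (0 < m)%N by rewrite -Dm.
have m0 : m%:R != 0 :> rat by rewrite pnatr_eq0 -lt0n.
have Em : m%:R = n%:R + 1 :> rat by rewrite -Dm natr1.
have mn : m%:R - n%:R = 1 :> rat by rewrite Em addrAC subrr add0r.
set X := \sum_(1 <= k < m) (-1) ^+ (k - 1) * m%:R * rho m k *
     harmonic (k - 1) 2 / (k%:R ^+ 2 * (m%:R - k%:R)).
have EX : X = (-1) ^+ n * rho m n / m%:R * ((m%:R ^+ 2)^-1 - harmonic n 2)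
              - (m%:R ^+ 4)^-1.
  have := @inv_quartic_expansion m n; rewrite -Dm ltnSn Dm -/X => /(_ isT).
  by rewrite mn mulr1 => <-; rewrite [RHS]addrC addKr.
have Erho : rho m n = 2 / m%:R * rho m m.
  have := @rhoS m n; rewrite -Dm ltnSn Dm mn mul1r => /(_ isT) ->.
  have -> : n%:R = m%:R - 1 :> rat by rewrite Em addrK.
  by field; rewrite -addrA subrK -mulr2n mulrn_eq0 m0.
have ER : \sum_(1 <= k < m)
      (-1) ^+ (k - 1) * harmonic (k - 1) 2 * rho n k / k%:R ^+ 3 =
  \sum_(1 <= k < m) (-1) ^+ (k - 1) * harmonic (k - 1) 2 * rho m k / k%:R ^+ 3
  + 2 / m%:R * X.
  rewrite /X big_distrr -big_split /=; apply: eq_big_nat => k /andP[k1 km].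
  rewrite (@rho_succ n k) ?Dm //; last by rewrite -ltnS Dm.
  have k0 : k%:R != 0 :> rat by rewrite pnatr_eq0 -lt0n.
  have km0 : m%:R - k%:R != 0 :> rat.
    by rewrite -natrB ?(ltnW km) // pnatr_eq0 subn_eq0 -ltnNge.
  by field; rewrite km0 k0 m0.
rewrite ER EX Erho rhonn in IHn.
rewrite !big_nat_recr //= rhonn (_ : (m - 1 = n)%N) -?Dm ?subn1 // harmonicS Dm.
have c0 : 'C(2 * m, m)%:R != 0 :> rat.
  by rewrite pnatr_eq0 -lt0n bin_gt0 leq_pmull.
move: IHn c0; set A := \sum_(1 <= k < m) _; set B := \sum_(1 <= k < m) _.
set R := \sum_(1 <= k < m) _; move: ('C(2 * m, m)%:R) => c IHn c0.
rewrite [LHS](_ : _ = (2 * A - 5 / 2 * B) + (2 * ((-1) ^+ n / (m%:R ^+ 5 * c))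
  - 5 / 2 * ((-1) ^+ n * harmonic n 2 / (m%:R ^+ 3 * c)))); last by ring.
by rewrite IHn; field; rewrite c0 m0.
Qed.

(** * Bernoulli numbers and Faulhaber's formula *)

Lemma fact_neq0 n : n`!%:R != 0 :> rat.
Proof. by rewrite pnatr_eq0 -lt0n fact_gt0. Qed.

Lemma bin_fact_rat n i : (i <= n)%N ->
  'C(n, i)%:R = n`!%:R / (i`!%:R * (n - i)`!%:R) :> rat.
Proof.
move=> le_in; rewrite -(bin_fact le_in) !natrM mulfK //.
by rewrite mulf_neq0 // fact_neq0.
Qed.

(** The defining recurrence of the Bernoulli numbers, cleared of
    factorials. *)
Lemma bernoulli_sum n : \sum_(i < n) 'C(n, i)%:R * bernoulli i = (n == 1)%:R.
Proof.
have := bernoulli_egf n; rewrite /fps_mul big_ord_recr /= subnn fact0 invr1.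
rewrite subrr mulr0 addr0 => /(congr1 (fun x => n`!%:R * x)).
have -> : n`!%:R * (n == 1)%:R = (n == 1)%:R :> rat.
  by case: eqP => [->|_]; rewrite ?mulr0 // mul1r.
move=> <-; rewrite big_distrr; apply: eq_bigr => i _ /=.
have lt_in := ltn_ord i.
rewrite bin_fact_rat 1?ltnW // subn_eq0 leqNgt lt_in subr0; field.
by rewrite !fact_neq0.
Qed.

Lemma bin_bin_swap n i l : (i + l <= n)%N ->
  'C(n, i)%:R * 'C(n - i, l)%:R = 'C(n, l)%:R * 'C(n - l, i)%:R :> rat.
Proof.
move=> le_iln; have le_in : (i <= n)%N by apply: leq_trans le_iln; apply: leq_addr.
have le_ln : (l <= n)%N by apply: leq_trans le_iln; apply: leq_addl.
rewrite !bin_fact_rat //; first last.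
- by rewrite leq_subRL.
- by rewrite leq_subRL // addnC.
by rewrite -!subnDA addnC; field; rewrite !fact_neq0.
Qed.

Lemma exprD1_sub (x : rat) n :
  (x + 1) ^+ n - x ^+ n = \sum_(l < n) 'C(n, l)%:R * x ^+ l.
Proof.
rewrite exprD1n big_ord_recr /= binn mulr1n addrK.
by apply: eq_bigr => l _; rewrite mulr_natl.
Qed.

(** Expand (x+1)^(n+1-i) - x^(n+1-i) in powers of x and exchange the sums:
    by [bin_bin_swap] the coefficient of x^l contains the Bernoulli
    recurrence for n+1-l, which vanishes unless l = n. *)
Lemma bernoulli_diff (x : rat) n :
  \sum_(i < n.+1) 'C(n.+1, i)%:R * bernoulli i
     * ((x + 1) ^+ (n.+1 - i) - x ^+ (n.+1 - i))
  = n.+1%:R * x ^+ n.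
Proof.
pose F (i l : nat) : rat :=
  'C(n.+1, i)%:R * 'C(n.+1 - i, l)%:R * bernoulli i * x ^+ l.
transitivity (\sum_(i < n.+1) \sum_(l < n.+1 | (i + l < n.+1)%N) F i l).
  apply: eq_bigr => i _; rewrite exprD1_sub big_distrr /=.
  rewrite (big_ord_widen n.+1
    (fun l => 'C(n.+1, i)%:R * bernoulli i * ('C(n.+1 - i, l)%:R * x ^+ l)))
    ?leq_subr //.
  apply: eq_big => [l|l _]; first by rewrite ltn_subRL.
  by rewrite /F; ring.
rewrite (exchange_big_dep xpredT) //=.
transitivity (\sum_(l < n.+1) 'C(n.+1, l)%:R * x ^+ l * (n.+1 - l == 1)%N%:R).
  apply: eq_bigr => l _; rewrite -bernoulli_sum big_distrr /=.
  rewrite (big_ord_widen n.+1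
    (fun i => 'C(n.+1, l)%:R * x ^+ l * ('C(n.+1 - l, i)%:R * bernoulli i)))
    ?leq_subr //.
  apply: eq_big => [i|i lt_il]; first by rewrite ltn_subRL addnC.
  rewrite /F bin_bin_swap; last exact: ltnW.
  by ring.
rewrite big_ord_recr /= big1 ?add0r => [|l _].
  by rewrite subSnn eqxx mulr1 -bin_sub // subSnn bin1.
have lt_ln := ltn_ord l.
by rewrite /= subSn ?(ltnW lt_ln) // eqSS subn_eq0 leqNgt lt_ln mulr0.
Qed.

Lemma faulhaber n k :
  n.+1%:R * \sum_(0 <= j < k) j%:R ^+ n
  = \sum_(i < n.+1) 'C(n.+1, i)%:R * bernoulli i * k%:R ^+ (n.+1 - i) :> rat.
Proof.
elim: k => [|k IHk].
  rewrite big_geq // mulr0 big1 // => i _.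
  by rewrite expr0n subn_eq0 leqNgt ltn_ord mulr0.
rewrite big_nat_recr //= mulrDr IHk -bernoulli_diff -big_split /=.
by apply: eq_bigr => i _; rewrite -natr1; ring.
Qed.

(** * Harmonic sums modulo p *)

(** The multiple harmonic sum of depth 2: the sum of 1/(j^a k^b) over
    0 < j < k < p. *)
Definition mhs2 (p a b : nat) : rat :=
  \sum_(1 <= k < p) harmonic (k - 1) a / k%:R ^+ b.

Section HarmonicModp.
Variables (p : nat) (p_prime : prime p).
Let p_gt0 : (0 < p)%N := prime_gt0 p_prime.
Let p_neq0 : p%:R != 0 :> rat.
Proof. by rewrite pnatr_eq0 -lt0n. Qed.

Lemma zloc_harmonic n a : (n < p)%N -> harmonic n a \is a zloc p.
Proof.
move=> lt_np; rewrite /harmonic big_nat; apply: rpred_sum => k /andP[k0 kn].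
by rewrite -exprVn rpredX // zlocV_lt // k0 (leq_trans kn).
Qed.

(** The recurrence for B_n divides by n + 1 only, so no factor p enters a
    denominator before B_(p-1). *)
Lemma zloc_bernoulli n : (n.+1 < p)%N -> bernoulli n \is a zloc p.
Proof.
elim/ltn_ind: n => n IHn lt_np.
have := bernoulli_sum n.+1; rewrite big_ord_recr /= -bin_sub // subSnn bin1.
have n0 : n.+1%:R != 0 :> rat by rewrite pnatr_eq0.
move/(canRL (addKr _))/(canRL (mulKf n0)) => ->.
apply: rpredM; first exact: zlocV_lt.
rewrite rpredD ?rpredN ?rpred_nat // rpred_sum // => i _.
by rewrite rpredM ?rpred_nat // IHn // (leq_ltn_trans (ltn_ord i)) // ltnW.
Qed.

Lemma congp_fermat k a : (0 < k < p)%N -> (a <= p.-1)%N ->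
  (k%:R ^+ a)^-1 == k%:R ^+ (p.-1 - a) %[modp p ^ 1].
Proof.
move=> /andP[k0 kp] le_ap.
have kZ : k%:R^-1 \is a zloc p by rewrite zlocV_lt ?k0.
have kn0 : k%:R != 0 :> rat by rewrite pnatr_eq0 -lt0n.
have k1 : k%:R ^+ p.-1 == 1 %[modp p ^ 1].
  have pk : coprime k p by rewrite coprime_sym prime_coprime // gtnNdvd.
  have := Euler_exp_totient pk; rewrite totient_prime // => /eqP.
  rewrite eqn_mod_dvd ?expn_gt0 ?k0 // => /dvdnP[q Eq].
  have -> : k%:R ^+ p.-1 = 1 + q%:R * p%:R :> rat.
    by rewrite -natrM -Eq natrB ?expn_gt0 ?k0 // natrX addrC subrK.
  by rewrite /congp expr1 addrAC subrr add0r mulfK // rpred_nat.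
rewrite congp_sym -[_ ^- a]mul1r.
rewrite (_ : k%:R ^+ (p.-1 - a) = k%:R ^+ p.-1 * (k%:R ^+ a)^-1).
  by apply: congpMr => //; rewrite -exprVn rpredX.
by rewrite -{2}(subnK le_ap) exprD mulfK // expf_neq0.
Qed.

(** Every term of Faulhaber's polynomial at p contains a factor p. *)
Lemma congp_power_sum n : (n.+1 < p)%N ->
  \sum_(0 <= k < p) k%:R ^+ n == 0 %[modp p ^ 1].
Proof.
move=> lt_np; have nZ : n.+1%:R^-1 \is a zloc p by rewrite zlocV_lt.
have n0 : n.+1%:R != 0 :> rat by rewrite pnatr_eq0.
set S := \sum_(_ <= k < _) _.
suff : n.+1%:R * S == 0 %[modp p ^ 1].
  by move=> /(congpMl nZ); rewrite mulKf // mulr0.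
rewrite /S faulhaber.
rewrite (eq_bigr (fun i : 'I_n.+1 =>
  p%:R * ('C(n.+1, i)%:R * bernoulli i * p%:R ^+ (n - i)))); last first.
  by move=> i _; rewrite subSn ?exprS; [ring | rewrite -ltnS].
rewrite -big_distrr; apply: zloc_congp0 => //; apply: rpred_sum => i _.
apply: rpredM; last by rewrite rpredX ?rpred_nat.
by rewrite rpredM ?rpred_nat // zloc_bernoulli // (leq_ltn_trans _ lt_np).
Qed.

Lemma congp_power_sum1 n : (0 < n)%N -> (n.+1 < p)%N ->
  \sum_(1 <= k < p) k%:R ^+ n == 0 %[modp p ^ 1].
Proof.
move=> n0 /congp_power_sum; rewrite big_ltn ?prime_gt0 //.
by rewrite expr0n eqn0Ngt n0 add0r.
Qed.

Lemma harmonic_predE a : harmonic p.-1 a = \sum_(1 <= k < p) (k%:R ^+ a)^-1.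
Proof. by rewrite /harmonic prednK ?prime_gt0. Qed.

Lemma congp_harmonic0 a : (0 < a < p.-1)%N -> harmonic p.-1 a == 0 %[modp p ^ 1].
Proof.
move=> /andP[a0 ap]; rewrite harmonic_predE.
apply: (@congp_trans _ _ (\sum_(1 <= k < p) k%:R ^+ (p.-1 - a))).
  by apply: congp_sum => k kp; apply: congp_fermat => //; apply: ltnW.
apply: congp_power_sum1; first by rewrite subn_gt0.
lia.
Qed.

Lemma zloc_mhs2 a b : mhs2 p a b \is a zloc p.
Proof.
rewrite /mhs2 big_nat; apply: rpred_sum => k k_lt.
rewrite -exprVn rpredM ?rpredX ?zlocV_lt // zloc_harmonic //; lia.
Qed.

Lemma mhs2_diag a : 2 * mhs2 p a a = harmonic p.-1 a ^+ 2 - harmonic p.-1 (2 * a).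
Proof.
rewrite /mhs2 -(prednK p_gt0) /=; elim: (p.-1) => [|n IHn].
  by rewrite big_geq // !harmonic0; ring.
rewrite big_nat_recr //= mulrDr IHn subn1 /= !harmonicS -!exprVn.
by rewrite mul2n -addnn exprD; ring.
Qed.

(** The quotient is a power of k with exponent strictly between -(p-1) and
    p-1; its sum over the nonzero residues vanishes unless the exponent
    is 0. *)
Lemma congp_power_quotient_sum e b : (0 < e < p)%N -> (0 < b < p)%N ->
  \sum_(1 <= k < p) k%:R ^+ e / k%:R ^+ b == - (e == b)%:R %[modp p ^ 1].
Proof.
move=> /andP[e0 ep] /andP[b0 bp].
have kn0 k : (1 <= k < p)%N -> k%:R != 0 :> rat.
  by case/andP=> k1 _; rewrite pnatr_eq0 -lt0n.
have p1 := prednK (prime_gt0 p_prime).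
case: ltngtP => [lt_eb|lt_be|->].
- rewrite oppr0 (_ : \sum_(1 <= k < p) _ = harmonic p.-1 (b - e)).
    apply: congp_harmonic0; rewrite subn_gt0 lt_eb /=.
    lia.
  rewrite harmonic_predE; apply: eq_big_nat => k /kn0 k0.
  by rewrite -{1}(subnK (ltnW lt_eb)) exprD invfM mulrCA mulfV ?mulr1 ?expf_neq0.
- rewrite oppr0 (_ : \sum_(1 <= k < p) _ = \sum_(1 <= k < p) k%:R ^+ (e - b)).
    apply: congp_power_sum1; rewrite ?subn_gt0 //.
    lia.
  apply: eq_big_nat => k /kn0 k0.
  by rewrite -{1}(subnK (ltnW lt_be)) exprD mulfK ?expf_neq0.
rewrite (_ : \sum_(1 <= k < p) _ = p.-1%:R).
  rewrite /congp opprK expr1 natr1 p1 divff // rpred1 //.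
rewrite (eq_big_nat _ _ (F2 := fun=> 1)) => [|k /kn0 k0].
  by rewrite sumr_const_nat subn1.
by rewrite divff ?expf_neq0.
Qed.

Lemma congp_harmonic_faulhaber a k : (0 < a < p.-1)%N -> (0 < k < p)%N ->
  (p - a)%:R * harmonic (k - 1) a
  == \sum_(i < p - a) 'C(p - a, i)%:R * bernoulli i * k%:R ^+ (p - a - i)
     %[modp p ^ 1].
Proof.
move=> /andP[a0 ap] /andP[k0 kp].
have pa : (p - a = (p.-1 - a).+1)%N by lia.
rewrite pa -faulhaber; apply: congpMl; first exact: rpred_nat.
rewrite /harmonic (@big_ltn _ _ _ 0) // expr0n subn_eq0 leqNgt ap add0r subn1 prednK //.
apply: congp_sum => j /andP[j1 jk]; apply: congp_fermat => //.
  by rewrite j1 (ltn_trans jk).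
exact: ltnW.
Qed.

(** Sum the polynomial of [congp_harmonic_faulhaber] against 1/k^b: only its
    monomial k^b survives, and that has coefficient
    'C(p-a,b) B_(p-a-b). *)
Lemma congp_mhs2 a b : (0 < a)%N -> (0 < b)%N -> (a + b < p)%N ->
  (p - a)%:R * mhs2 p a b
  == - ('C(p - a, b)%:R * bernoulli (p - a - b)) %[modp p ^ 1].
Proof.
move=> a0 b0 abp; have p1 : (1 < p)%N := prime_gt1 p_prime.
pose c i : rat := 'C(p - a, i)%:R * bernoulli i.
apply: (@congp_trans _ _ (\sum_(1 <= k < p) \sum_(i < p - a)
    c i * (k%:R ^+ (p - a - i) / k%:R ^+ b))).
  rewrite /mhs2 big_distrr; apply: congp_sum => k k1 /=.
  rewrite mulrA (eq_bigr (fun i : 'I_(p - a) =>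
    c i * k%:R ^+ (p - a - i) / k%:R ^+ b)); last first.
    by move=> i _; rewrite mulrA.
  rewrite -big_distrl; apply: congpMr.
    by rewrite -exprVn rpredX // zlocV_lt.
  by apply: congp_harmonic_faulhaber => //; lia.
rewrite exchange_big.
have lt_i0 : (p - a - b < p - a)%N by lia.
rewrite -(bin_sub (n := p - a) (m := b)); last by lia.
have -> : - ('C(p - a, p - a - b)%:R * bernoulli (p - a - b)) =
   \sum_(0 <= i < p - a) c i * - (p - a - i == b)%N%:R.
  rewrite big_mkord (bigD1 (Ordinal lt_i0)) //= big1 => [|i ne_i].
    by rewrite subKn ?eqxx ?addr0 ?mulrN1 //; lia.
  rewrite (_ : _ == b = false) ?oppr0 ?mulr0 //; apply/eqP => Ei.
  by case/eqP: ne_i; apply: val_inj => /=; lia.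
rewrite -(big_mkord xpredT (fun i =>
  \sum_(1 <= k < p) c i * (k%:R ^+ (p - a - i) / k%:R ^+ b))).
apply: congp_sum => i /andP[_ lt_i]; rewrite -big_distrr.
apply: congpMl; last by apply: congp_power_quotient_sum => //; lia.
by rewrite rpredM ?rpred_nat // zloc_bernoulli //; lia.
Qed.

End HarmonicModp.

(** * Complete symmetric functions of reciprocals *)

(** The sum of 1/(k_1 ... k_a) over n >= k_1 >= ... >= k_a >= 1, that is,
    the complete symmetric function h_a of 1, 1/2, ..., 1/n. *)
Fixpoint star_sum (a n : nat) : rat :=
  if a is a'.+1 then \sum_(1 <= k < n.+1) star_sum a' k / k%:R else 1.

Lemma star_sumS a n :
  star_sum a.+1 n.+1 = star_sum a.+1 n + star_sum a n.+1 / n.+1%:R.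
Proof. by rewrite /= big_nat_recr. Qed.

Lemma alternating_bin_sum n : \sum_(i < n.+1) (-1) ^+ i * 'C(n.+1, i.+1)%:R = 1 :> rat.
Proof.
have := exprDn (1 : rat) (-1) n.+1; rewrite subrr expr0n big_ord_recl /= bin0.
rewrite expr1n mulr1 mulr1n => /eqP; rewrite eq_sym addr_eq0 eq_sym => /eqP E.
rewrite -[RHS]E -sumrN; apply: eq_bigr => i _ /=.
by rewrite expr1n mul1r exprS mulN1r mulNrn opprK mulr_natr.
Qed.

(** Pascal's rule and i 'C(n,i) = n 'C(n-1,i-1) show that the left-hand
    side obeys the recurrence [star_sumS]. *)
Lemma star_sum_bin a n :
  \sum_(i < n.+1) (-1) ^+ i * 'C(n.+1, i.+1)%:R / i.+1%:R ^+ a = star_sum a n.+1.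
Proof.
elim: a n => [|a IHa] n.
  rewrite /= -[RHS](alternating_bin_sum n); apply: eq_bigr => i _.
  by rewrite divr1.
elim: n => [|n IHn].
  rewrite big_ord1 /= big_nat1 binn expr0 expr1n !mulr1 -IHa big_ord1 /=.
  by rewrite binn expr1n mul1r.
rewrite star_sumS -IHn -IHa.
rewrite big_distrl /= [X in X + _](_ : _ = \sum_(i < n.+2)
   (-1) ^+ i * 'C(n.+1, i.+1)%:R / i.+1%:R ^+ a.+1).
  rewrite -big_split; apply: eq_bigr => i _ /=.
  have i0 : i.+1%:R != 0 :> rat by rewrite pnatr_eq0.
  have n0 : n.+2%:R != 0 :> rat by rewrite pnatr_eq0.
  rewrite [in LHS](binS n.+1) [in RHS](binS_rat n.+1 i) natrD exprS.
  move: (i.+1%:R) (n.+2%:R) i0 n0 => u v u0 v0; field.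
  by rewrite v0 expf_neq0 ?u0.
by rewrite [RHS]big_ord_recr /= bin_small // mulr0 mul0r addr0.
Qed.

(** Newton's identity for h_4 in terms of power sums; those for h_1, h_2 and
    h_3 are proved along the way, each by induction on n. *)
Lemma star_sum_newton4 n :
  24%:R * star_sum 4 n = 6%:R * harmonic n 4 + 8%:R * harmonic n 1 * harmonic n 3
    + 3%:R * harmonic n 2 ^+ 2 + 6%:R * harmonic n 1 ^+ 2 * harmonic n 2
    + harmonic n 1 ^+ 4.
Proof.
have E1 m : star_sum 1 m = harmonic m 1.
  by rewrite /= /harmonic; apply: eq_bigr => k _; rewrite mul1r.
have star0 a : star_sum a.+1 0 = 0 by rewrite /= big_geq.
have E2 m : 2%:R * star_sum 2 m = harmonic m 2 + harmonic m 1 ^+ 2.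
  elim: m => [|m IHm]; first by rewrite star0 !harmonic0; ring.
  rewrite star_sumS mulrDr IHm E1 !harmonicS -!exprVn; ring.
have E3 m : 6%:R * star_sum 3 m =
    2%:R * harmonic m 3 + 3%:R * harmonic m 1 * harmonic m 2 + harmonic m 1 ^+ 3.
  elim: m => [|m IHm]; first by rewrite star0 !harmonic0; ring.
  rewrite star_sumS mulrDr IHm.
  rewrite (_ : 6%:R * _ = 3%:R * (2%:R * star_sum 2 m.+1) / m.+1%:R); last by ring.
  by rewrite E2 !harmonicS -!exprVn; ring.
elim: n => [|n IHn]; first by rewrite star0 !harmonic0; ring.
rewrite star_sumS mulrDr IHn.
rewrite (_ : 24%:R * _ = 4%:R * (6%:R * star_sum 3 n.+1) / n.+1%:R); last by ring.
by rewrite E3 !harmonicS -!exprVn; ring.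
Qed.

(** * Congruences modulo the square of p *)

Section ModSquare.
Variables (p : nat) (p_prime : prime p).
Let p_gt0 : (0 < p)%N := prime_gt0 p_prime.

(** (-1)^k 'C(p-1,k) is the product of the 1 - p/j for j <= k. *)
Lemma congp_signed_bin k : (k < p)%N ->
  (-1) ^+ k * 'C(p.-1, k)%:R == 1 - p%:R * harmonic k 1 %[modp p ^ 2].
Proof.
elim: k => [_|k IHk lt_kp].
  by rewrite bin0 mulr1 harmonic0 mulr0 subr0 congp_refl.
have k0 : k.+1%:R != 0 :> rat by rewrite pnatr_eq0.
have kZ : k.+1%:R^-1 \is a zloc p by rewrite zlocV_lt.
have hZ : harmonic k 1 \is a zloc p by rewrite zloc_harmonic // ltnW.
have -> : 'C(p.-1, k.+1)%:R = (p%:R / k.+1%:R - 1) * 'C(p.-1, k)%:R :> rat.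
  apply: (mulfI k0); rewrite -natrM mul_bin_left natrM.
  have -> : (p.-1 - k = p - k.+1)%N by lia.
  by rewrite natrB 1?ltnW //; field; rewrite nat1r.
rewrite exprS (_ : _ * _ = (1 - p%:R / k.+1%:R)
  * ((-1) ^+ k * 'C(p.-1, k)%:R)); last by ring.
apply: congp_trans (congpMl _ (IHk (ltnW lt_kp))) _.
  by rewrite rpredB ?rpred1 // rpredM ?rpred_nat.
rewrite harmonicS expr1 /congp.
rewrite (_ : _ - _ = harmonic k 1 / k.+1%:R * p%:R ^+ 2); last by ring.
by rewrite mulfK ?rpredM // expf_neq0 // pnatr_eq0 -lt0n.
Qed.

Lemma congp_bin_pred k : (k < p)%N -> 'C(p.-1, k)%:R == (-1) ^+ k %[modp p ^ 1].
Proof.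
move=> lt_kp.
have bZ : (-1) ^+ k \is a zloc p by rewrite rpredX // rpredN rpred1.
have := congpMl bZ (congpW p_prime (leqnSn 1) (congp_signed_bin lt_kp)).
rewrite mulrA -exprMn mulrNN mulr1 expr1n mul1r => /congp_trans; apply.
rewrite -congp_sub0 (_ : _ - _ = p%:R * (- (-1) ^+ k * harmonic k 1)); last by ring.
apply: zloc_congp0 => //.
by rewrite rpredM ?rpredN // zloc_harmonic.
Qed.

(** For k > 0, p (-1)^k rho(p-1,k) is k^2/(k-p) divided by the product of
    the 1 - p^2/j^2 for 0 < j < k.  The latter is 1 modulo p^2, and
    k^2/(k-p) - (k+p) = p^2/(k-p). *)
Lemma congp_rho k : (0 < k < p)%N ->
  p%:R * ((-1) ^+ k * rho p.-1 k) == k%:R + p%:R %[modp p ^ 2].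
Proof.
have p0 : p%:R != 0 :> rat by rewrite pnatr_eq0 -lt0n.
have pE : p.-1%:R = p%:R - 1 :> rat by rewrite -subn1 natrB.
case/andP; elim: k => // k IHk _ lt_kp.
have kp0 : (p - k.+1)%:R != 0 :> rat by rewrite pnatr_eq0; lia.
have pkE : (p - k.+1)%:R = p%:R - k%:R - 1 :> rat.
  by rewrite natrB 1?ltnW // -natr1 opprD addrA.
have pkZ : (p - k.+1)%:R^-1 \is a zloc p by rewrite zlocV_lt //; lia.
have kp1 : k%:R + p%:R != 0 :> rat by rewrite -natrD pnatr_eq0; lia.
have stepE : k.+1%:R ^+ 2 / - (p - k.+1)%:R == k.+1%:R + p%:R %[modp p ^ 2].
  rewrite /congp (_ : _ - _ = - (p - k.+1)%:R^-1 * p%:R ^+ 2).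
    by rewrite mulfK ?rpredN // expf_neq0.
  rewrite pkE -natr1 in kp0 *; field.
  by rewrite kp0.
have rhoE : p%:R * ((-1) ^+ k.+1 * rho p.-1 k.+1) =
  p%:R * ((-1) ^+ k * rho p.-1 k) / (k%:R + p%:R) * (k.+1%:R ^+ 2 / - (p - k.+1)%:R).
  rewrite rhoS; last by lia.
  rewrite exprS pE pkE in kp0 *; field.
  by rewrite kp0 kp1.
(* At k = 0 the inverse of k + p is not p-integral, but there the
   recurrence starts from the exact value p. *)
rewrite rhoE; case: k => [|k] in IHk lt_kp kp0 pkE pkZ kp1 stepE rhoE *.
  by move: stepE; rewrite rhon0 expr0 !mulr1 add0r mulfV ?mul1r.
apply: congp_trans stepE.
have kpZ : (k.+1%:R + p%:R)^-1 \is a zloc p.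
  rewrite -natrD zlocV // prime_coprime // dvdn_addl // gtnNdvd //.
  exact: ltnW.
have tZ : k.+2%:R ^+ 2 / - (p - k.+2)%:R \is a zloc p.
  by rewrite invrN rpredM ?rpredN // rpredX // rpred_nat.
have := congpMr tZ (congpMr kpZ (IHk isT (ltnW lt_kp))).
by rewrite mulfV // mul1r.
Qed.

(** Insert the expansion of (-1)^k 'C(p-1,k) into [star_sum_bin]; the term
    H_k(1)/k^4 splits into H_(k-1)(1)/k^4 and 1/k^5. *)
Lemma congp_star_sum4 :
  star_sum 4 p.-1 == - harmonic p.-1 4 + p%:R * (mhs2 p 1 4 + harmonic p.-1 5)
    %[modp p ^ 2].
Proof.
have [n En] : exists n, p.-1 = n.+1.
  by exists p.-2; have := prime_gt1 p_prime; lia.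
rewrite {1}En -star_sum_bin -En.
rewrite (_ : \sum_(i < p.-1) _ = \sum_(1 <= k < p)
  ((-1) ^+ k * 'C(p.-1, k)%:R) * - (k%:R ^+ 4)^-1); last first.
  rewrite -[X in \sum_(1 <= k < X) _](prednK p_gt0) big_add1 /= big_mkord.
  by apply: eq_bigr => i _; rewrite (exprS _ i); ring.
rewrite [X in congp _ _ _ X](_ : _ = \sum_(1 <= k < p)
  (1 - p%:R * harmonic k 1) * - (k%:R ^+ 4)^-1).
  apply: congp_sum => k /andP[k1 lt_kp]; apply: congpMr.
    by rewrite rpredN -exprVn rpredX // zlocV_lt ?k1.
  exact: congp_signed_bin.
rewrite /mhs2 !harmonic_predE // -big_split /= big_distrr -sumrN -big_split /=.
apply: eq_big_nat => -[//|k] _; rewrite subn1 /= harmonicS -!exprVn; ring.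
Qed.

Hypothesis p_ge7 : (6 < p)%N.

(** Compare the two evaluations of h_4: [congp_star_sum4] gives
    - H_(p-1)(4) + p H(1,4), and Newton's identity gives H_(p-1)(4)/4 modulo
    p^2, all other terms being products of power sums of which at least two
    are divisible by p. *)
Lemma congp_harmonic4 :
  harmonic p.-1 4 == p%:R * (4 / 5 * mhs2 p 1 4) %[modp p ^ 2].
Proof.
have h0 a : (0 < a < 6)%N -> harmonic p.-1 a == 0 %[modp p ^ 1].
  by move=> a6; apply: congp_harmonic0 => //; lia.
have hh a b : (0 < a < 6)%N -> (0 < b < 6)%N ->
  harmonic p.-1 a * harmonic p.-1 b == 0 %[modp p ^ 2].
  by move=> a6 b6; apply: (@congpM0 p 1 1); apply: h0.
have hZ a : harmonic p.-1 a \is a zloc p by rewrite zloc_harmonic // ltn_predL.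
have p30 : coprime p 30.
  rewrite (_ : 30 = 2 * (3 * 5))%N // !coprimeMr !prime_coprime //.
  rewrite !gtnNdvd //; lia.
have E3 : p%:R * harmonic p.-1 5 == 0 %[modp p ^ 2].
  by rewrite -(mulr0 p%:R) congp_pscale // h0.
have D0 x y : x == 0 %[modp p ^ 2] -> y == 0 %[modp p ^ 2] ->
  x + y == 0 %[modp p ^ 2].
  by rewrite -{3}[0]addr0; apply: congpD.
have M0 c x : c \is a zloc p -> x == 0 %[modp p ^ 2] ->
  c * x == 0 %[modp p ^ 2].
  by move=> cZ /(congpMl cZ); rewrite mulr0.
have E1 := congp_star_sum4.
have N4 := star_sum_newton4 p.-1.
rewrite -congp_sub0 in E1; rewrite -congp_sub0.
set H4 := harmonic p.-1 4 in E1 N4 *; set M := mhs2 p 1 4 in E1 *.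
set H5 := harmonic p.-1 5 in E1 E3.
set S := star_sum 4 p.-1 in E1 N4.
pose h a := harmonic p.-1 a.
have E2 : 24%:R * S - 6%:R * H4 == 0 %[modp p ^ 2].
  rewrite (_ : _ - _ = 8%:R * (h 1%N * h 3%N) + 3%:R * (h 2%N * h 2%N)
    + 6%:R * h 2%N * (h 1%N * h 1%N) + h 1%N ^+ 2 * (h 1%N * h 1%N)); last first.
    by rewrite N4 /h; ring.
  apply: (D0); [apply: (D0); [apply: (D0)|]|]; apply: (M0); try exact: hh.
  - exact: rpred_nat.
  - exact: rpred_nat.
  - by rewrite rpredM ?rpred_nat ?hZ.
  - by rewrite rpredX ?hZ.
(* Eliminating S between S = - H4 + p (M + H5) and 24 S = 6 H4 leaves
   30 H4 = 24 p M. *)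
rewrite (_ : _ - _ = 30%:R^-1 * (24%:R * (S - (- H4 + p%:R * (M + H5)))
   - (24%:R * S - 6%:R * H4) + 24%:R * (p%:R * H5))); last by field.
apply: (M0); first exact: zlocV.
apply: (D0); last by apply: (M0) => //; apply: rpred_nat.
rewrite -[0](subrr 0); apply: congpB => //.
by apply: (M0) => //; apply: rpred_nat.
Qed.

(** By [congp_rho], p times the sum is - H(2,2) - p H(2,3) modulo p^2, and
    H(2,2) is - H_(p-1)(4)/2 modulo p^2; [congp_harmonic4] supplies the factor p
    that cancels. *)
Lemma congp_koecher_tail :
  \sum_(1 <= k < p)
     (-1) ^+ (k - 1) * harmonic (k - 1) 2 * rho p.-1 k / k%:R ^+ 3
  == 2 / 5 * mhs2 p 1 4 - mhs2 p 2 3 %[modp p ^ 1].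
Proof.
rewrite -(congp_pscale p_prime) big_distrr /=.
apply: (@congp_trans p _ (- (mhs2 p 2 2 + p%:R * mhs2 p 2 3))).
  rewrite /mhs2 big_distrr -big_split -sumrN /=.
  apply: congp_sum => k k_lt; have k0 : k%:R != 0 :> rat by rewrite pnatr_eq0; lia.
  have := congp_rho k_lt.
  have cZ : - (harmonic (k - 1) 2 / k%:R ^+ 3) \is a zloc p.
    by rewrite rpredN -exprVn rpredM ?rpredX ?zlocV_lt // zloc_harmonic //; lia.
  move/(congpMl cZ).
  set t := _ * rho p.-1 k / _.
  have -> : - (harmonic (k - 1) 2 / k%:R ^+ 3)
    * (p%:R * ((-1) ^+ k * rho p.-1 k)) = p%:R * t.
    rewrite /t; case: k {cZ k_lt t} k0 => [|k] k0; first by rewrite eqxx in k0.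
    by rewrite subn1 /= (exprS _ k) -exprVn; ring.
  suff -> : - (harmonic (k - 1) 2 / k%:R ^+ 3) * (k%:R + p%:R) =
    - (harmonic (k - 1) 2 / k%:R ^+ 2
       + p%:R * (harmonic (k - 1) 2 / k%:R ^+ 3)) by [].
  by field.
have D22 : mhs2 p 2 2 = 2^-1 * (harmonic p.-1 2 ^+ 2 - harmonic p.-1 4).
  by rewrite -[4%N]/(2 * 2)%N -mhs2_diag ?mulKf.
have Z2 : 2^-1 \is a zloc p by rewrite (@zlocV_lt p 2) //; lia.
have H22 : harmonic p.-1 2 ^+ 2 == 0 %[modp p ^ 2].
  by apply: (@congpM0 p 1 1); apply: congp_harmonic0 => //; lia.
rewrite (_ : - _ = 2^-1 * (harmonic p.-1 4 - harmonic p.-1 2 ^+ 2)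
  - p%:R * mhs2 p 2 3); last first.
  by rewrite D22; ring.
rewrite (_ : p%:R * (_ - _) = 2^-1 * (p%:R * (4 / 5 * mhs2 p 1 4) - 0)
  - p%:R * mhs2 p 2 3); last by field.
apply: congpB => //; last exact: congp_refl.
apply: congpMl => //; apply: congpB => //; exact: congp_harmonic4.
Qed.

End ModSquare.

(** * The congruence *)

Section Assembly.
Variables (p : nat) (p_prime : prime p) (p_ge7 : (6 < p)%N).
Let p_gt0 : (0 < p)%N := prime_gt0 p_prime.
Let B := bernoulli (p - 5).
Let B_zloc : B \is a zloc p.
Proof. by apply: zloc_bernoulli => //; lia. Qed.

(** [congp_mhs2] with p - 1 = -1 and 'C(p-1,4) = 1 modulo p. *)
Lemma congp_mhs2_14 : mhs2 p 1 4 == B %[modp p ^ 1].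
Proof.
have M := @congp_mhs2 p p_prime 1 4 isT isT (ltnW p_ge7).
rewrite (_ : (p - 1 - 4 = p - 5)%N) -?/B ?subnDA // ?subn1 in M; last by lia.
rewrite (_ : mhs2 _ _ _ = p%:R * mhs2 p 1 4 - p.-1%:R * mhs2 p 1 4); last first.
  by rewrite -{2}(prednK p_gt0) -natr1; ring.
rewrite (_ : B = 0 - - (1 * B)); last by ring.
apply: congpB; first by apply: zloc_congp0 (zloc_mhs2 _ _ _).
apply: (congp_trans M); apply: congpN; apply: congpMr => //.
have := @congp_bin_pred _ p_prime 4; rewrite (_ : (-1) ^+ 4 = 1 :> rat) //; apply; lia.
Qed.

(** [congp_mhs2] with p - 2 = -2 and 'C(p-2,3) = -4 modulo p. *)
Lemma congp_mhs2_23 : mhs2 p 2 3 == - 2 * B %[modp p ^ 1].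
Proof.
have M := @congp_mhs2 p p_prime 2 3 isT isT (ltnW p_ge7).
rewrite (_ : (p - 2 - 3 = p - 5)%N) -?/B in M; last by lia.
have Z2 : 2^-1 \is a zloc p by rewrite (@zlocV_lt p 2) //; lia.
have C3 : 'C(p - 2, 3)%:R == - 4%:R %[modp p ^ 1].
  have E : (p.-1%:R) * 'C(p - 2, 3)%:R = (p - 4)%:R * 'C(p.-1, 3)%:R :> rat.
    rewrite -!natrM; congr (_%:R).
    by have := mul_bin_down p.-1 3; rewrite -!subn1 -!subnDA.
  rewrite [X in congp _ _ X](_ : _ =
    p%:R * ('C(p - 2, 3)%:R - 'C(p.-1, 3)%:R) + 4 * 'C(p.-1, 3)%:R).
    rewrite [X in congp _ _ _ X](_ : _ = 0 + 4 * (-1) ^+ 3); last by ring.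
    apply: congpD; first by apply: zloc_congp0; rewrite ?rpredB ?rpred_nat.
    apply: congpMl; first exact: rpred_nat.
    by apply: congp_bin_pred => //; lia.
  move: E; rewrite natrB; last by lia.
  rewrite -subn1 natrB // => E; lra.
rewrite (_ : mhs2 _ _ _ =
  2^-1 * (p%:R * mhs2 p 2 3 - (p - 2)%:R * mhs2 p 2 3)); last first.
  by rewrite natrB; [field | lia].
rewrite (_ : -2 * B = 2^-1 * (0 - - (- 4%:R * B))); last by field.
apply: congpMl => //; apply: congpB; first by apply: zloc_congp0 (zloc_mhs2 _ _ _).
by apply: (congp_trans M); apply: congpN; apply: congpMr.
Qed.

(** H_(p-1)(5) vanishes modulo p, and the tail contributes
    - (2/5 + 2)/2 = - 6/5 times B_(p-5). *)
Lemma koecher_congruence :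
    (2 * \sum_(1 <= k < p) (-1) ^+ (k - 1) / (k%:R ^+ 5 * 'C(2 * k, k)%:R)
     - 5 / 2 * \sum_(1 <= k < p) (-1) ^+ (k - 1) * harmonic (k - 1) 2
                                 / (k%:R ^+ 3 * 'C(2 * k, k)%:R))
   == (- (6 / 5) * bernoulli (p - 5)) %[modp p ^ 1].
Proof.
have Z2 : 2^-1 \is a zloc p by rewrite (@zlocV_lt p 2) //; lia.
have Z5 : 5^-1 \is a zloc p by rewrite (@zlocV_lt p 5) //; lia.
have := koecher_finite p.-1; rewrite prednK // => ->.
rewrite -/B (_ : _ * B = 0 - 2^-1 * (2 / 5 * B - -2 * B)); last by field.
apply: congpB; first by apply: congp_harmonic0 => //; lia.
apply: congpMl => //; apply: (congp_trans (congp_koecher_tail p_prime p_ge7)).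
apply: congpB congp_mhs2_23; apply: congpMl congp_mhs2_14.
by rewrite rpredM ?rpred_nat.
Qed.

End Assembly.

(** A direct evaluation: B_0 = 1, and the difference of the two sides,
    divided by 5, is 5^2 7793 / (2^8 3^5 7), with 7793 = 60 * 130 - 7. *)
Lemma koecher_congruence5 :
   eq_mod_rat 5 1
    (2 * \sum_(1 <= k < 5) (-1) ^+ (k - 1) / (k%:R ^+ 5 * 'C(2 * k, k)%:R)
     - 5 / 2 * \sum_(1 <= k < 5) (-1) ^+ (k - 1) * harmonic (k - 1) 2
                                 / (k%:R ^+ 3 * 'C(2 * k, k)%:R))
    (- (6 / 5) * bernoulli (5 - 5)).
Proof.
apply: eq_mod_ratP => //.
rewrite (_ : bernoulli _ = 1); last first.
  by have := bernoulli_sum 1; rewrite big_ord1 bin0 mul1r.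
rewrite /harmonic unlock /=.
have -> : 'C(2 * 1, 1) = 2%N by [].
have -> : 'C(2 * 2, 2) = 6%N by [].
have -> : 'C(2 * 3, 3) = 20%N by [].
have -> : 'C(2 * 4, 4) = 70%N by [].
rewrite /congp [X in X \is a _](_ : _ = 25%:R * (60%:R * 130%:R - 7%:R) *
  2%:R^-1 ^+ 8 * 3%:R^-1 ^+ 5 * 7%:R^-1); last by field.
apply: rpredM; last exact: zlocV.
apply: rpredM; last by apply: rpredX; apply: zlocV.
apply: rpredM; last by apply: rpredX; apply: zlocV.
apply: rpredM; first exact: rpred_nat.
by apply: rpredB; [apply: rpredM|]; apply: rpred_nat.
Qed.

Theorem theorem3 (p : nat) (p_prime : prime p) (p_gt3 : (3 < p)%N) :
  eq_mod_rat p 1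
    (2 * \sum_(1 <= k < p) (-1) ^+ (k - 1) / (k%:R ^+ 5 * 'C(2 * k, k)%:R)
     - 5 / 2 * \sum_(1 <= k < p) (-1) ^+ (k - 1) * harmonic (k - 1) 2
                                 / (k%:R ^+ 3 * 'C(2 * k, k)%:R))
    (- (6 / 5) * bernoulli (p - 5)).
Proof.
have [p5|p_neq5] := eqVneq p 5; first by rewrite p5; apply: koecher_congruence5.
apply: eq_mod_ratP => //; apply: koecher_congruence => //.
have p_neq4 : p != 4 by apply: contraTneq p_prime => ->.
have p_neq6 : p != 6 by apply: contraTneq p_prime => ->.
by lia.
Qed.
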